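(* Let $L_1$ and $L_2$ be regular languages. Then $GSA(L_1,L_2)$ is a regular language.
   Context: For words $w_1,w_2$ and a nonempty word $x$ that is a substring of both, $GSA_x(w_1,w_2)=\{u_1xv_1,u_2xv_2,u_1xv_2,u_2xv_1 : w_1=u_1xv_1,\ w_2=u_2xv_2\}$ over all such factorizations; $GSA(w_1,w_2)=\bigcup_x GSA_x(w_1,w_2)$ over all nonempty common substrings $x$; and $GSA(L_1,L_2)=\bigcup_{w_1\in L_1,w_2\in L_2}GSA(w_1,w_2)$. *)

(* Defs.v *)
From mathcomp Require Import all_boot.

Set Implicit Arguments.
Unset Strict Implicit.
Unset Printing Implicit Defensive.

Definition language (A : finType) := seq A -> Prop.

Record dfa (A : finType) := Dfa {
  dfa_state : finType;
  dfa_init : dfa_state;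
  dfa_final : {set dfa_state};
  dfa_trans : dfa_state -> A -> dfa_state
}.

Definition dfa_accept (A : finType) (M : dfa A) (w : seq A) : bool :=
  foldl (@dfa_trans A M) (dfa_init M) w \in dfa_final M.

Definition regular (A : finType) (L : language A) : Prop :=
  exists M : dfa A, forall w : seq A, L w <-> dfa_accept M w.

(* The factorizations are existentially quantified because x may occur at
   several positions in w1 and in w2. *)
Definition GSA_at (A : finType) (x w1 w2 : seq A) : language A := fun z =>
  exists u1 v1 u2 v2 : seq A,
    [/\ w1 = u1 ++ x ++ v1,
        w2 = u2 ++ x ++ v2 &
        z \in [:: u1 ++ x ++ v1; u2 ++ x ++ v2;
                  u1 ++ x ++ v2; u2 ++ x ++ v1]].

Definition GSA_word (A : finType) (w1 w2 : seq A) : language A := fun z =>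
  exists x : seq A,
    [/\ x != [::], infix x w1, infix x w2 & GSA_at x w1 w2 z].

Definition GSA (A : finType) (L1 L2 : language A) : language A := fun z =>
  exists w1 w2 : seq A, [/\ L1 w1, L2 w2 & GSA_word w1 w2 z].

(* Main.v *)
Require Import Defs.
From mathcomp Require Import all_boot.

Set Implicit Arguments.
Unset Strict Implicit.
Unset Printing Implicit Defensive.

(**
A common substring x = a x' may be replaced by its first letter a, the rest x'
being absorbed in the right contexts. So every word of GSA(L1, L2) is p a q,
where p and a decide which states a second automaton may be in after a, and
reading q from one of these states leads to a final state. Such a language is
recognised by running the first automaton together with the set of all states
that the second one may have reached from the positions read so far.
*)

Lemma regular_ext (A : finType) (L L' : language A) :
  (forall w, L w <-> L' w) -> regular L -> regular L'.
Proof. by move=> eqL [M LM]; exists M => w; split=> [/eqL/LM|/LM/eqL]. Qed.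

Lemma regularU (A : finType) (L L' : language A) :
  regular L -> regular L' -> regular (fun w => L w \/ L' w).
Proof.
move=> [M LM] [N LN].
pose d (s : dfa_state M * dfa_state N) a :=
  (dfa_trans s.1 a, dfa_trans s.2 a).
exists (Dfa (dfa_init M, dfa_init N)
  [set s | (s.1 \in dfa_final M) || (s.2 \in dfa_final N)] d) => w.
have run s : foldl d s w =
    (foldl (@dfa_trans A M) s.1 w, foldl (@dfa_trans A N) s.2 w).
  by elim: w s => [[]|a w IH s] //=; rewrite IH.
rewrite /dfa_accept /= run inE; split=> [[/LM|/LN] acc|/orP[/LM|/LN]].
- by apply/orP; left.
- by apply/orP; right.
- by left.
- by right.
Qed.

Section Reachability.
Variables (A : finType) (M : dfa A).
Implicit Types (s t : dfa_state M) (a : A).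

(** Graph connectivity rather than existence of a word keeps this boolean, so that [live] and
    [enters] can serve in the boolean relation [R] of [regular_jump]. *)
Definition reach : rel (dfa_state M) :=
  connect [rel s t | [exists a, t == dfa_trans s a]].

Definition live s := [exists t in dfa_final M, reach s t].

Definition enters a t :=
  [exists s, reach (dfa_init M) s && (t == dfa_trans s a)].

Lemma reachP s t :
  reflect (exists w, foldl (@dfa_trans A M) s w = t) (reach s t).
Proof.
apply: (iffP connectP) => [[p]|[w <-]].
  elim: p s => [|r p IH] s /= => [_ ->|/andP[/existsP[a /eqP r_def] rp] lt].
    by exists [::].
  by have [w <-] := IH _ rp lt; exists (a :: w); rewrite r_def.
elim: w s => [|a w IH] s; first by exists [::].
have [p rp lt] := IH (dfa_trans s a).
by exists (dfa_trans s a :: p); rewrite //= rp andbT; apply/existsP; exists a.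
Qed.

Lemma liveP s :
  reflect (exists w, foldl (@dfa_trans A M) s w \in dfa_final M) (live s).
Proof.
apply: (iffP exists_inP) => [[t tF /reachP[w wt]]|[w wF]].
  by exists w; rewrite wt.
by exists (foldl (@dfa_trans A M) s w) => //; apply/reachP; exists w.
Qed.

Lemma entersP a t :
  reflect (exists u, dfa_trans (foldl (@dfa_trans A M) (dfa_init M) u) a = t)
          (enters a t).
Proof.
apply: (iffP existsP) => [[s /andP[/reachP[u <-] /eqP->]]|[u <-]].
  by exists u.
exists (foldl (@dfa_trans A M) (dfa_init M) u); rewrite eqxx andbT.
by apply/reachP; exists u.
Qed.

End Reachability.

(** A subset construction: the jump from [M] to [N] may occur at any letter, so all its outcomes are
    tracked at once. [R] is left arbitrary to serve both kinds of words in GSA. *)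
Lemma regular_jump (A : finType) (M N : dfa A)
    (R : dfa_state M -> A -> pred (dfa_state N)) :
  regular (fun z => exists p a q t,
    [/\ z = p ++ a :: q, R (foldl (@dfa_trans A M) (dfa_init M) p) a t
      & foldl (@dfa_trans A N) t q \in dfa_final N]).
Proof.
(* Jumps already made advance by [a]; new ones are made at this [a], from the state of [M] before
   it. *)
pose d (S : dfa_state M * {set dfa_state N}) a :=
  (dfa_trans S.1 a, [set @dfa_trans A N t a | t in S.2] :|: [set t | R S.1 a t]).
exists (Dfa (dfa_init M, set0) [set S | S.2 :&: dfa_final N != set0] d) => z.
rewrite /dfa_accept /= inE.
have run1 w : (foldl d (dfa_init M, set0) w).1 =
    foldl (@dfa_trans A M) (dfa_init M) w.
  by elim/last_ind: w => [|w a IH] //; rewrite !foldl_rcons /= IH.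
have run2 w r : reflect (exists p a q t,
    [/\ w = p ++ a :: q, R (foldl (@dfa_trans A M) (dfa_init M) p) a t
      & foldl (@dfa_trans A N) t q = r]) (r \in (foldl d (dfa_init M, set0) w).2).
  elim/last_ind: w r => [|w b IH] r.
    by rewrite inE; constructor=> -[[|? ?] [a [q [t []]]]].
  rewrite foldl_rcons /= !inE run1; apply: (iffP orP).
    case=> [/imsetP[r' /IH[p [a [q [t [-> Rt <-]]]]] ->]|Rr].
      by exists p, a, (rcons q b), t; rewrite foldl_rcons rcons_cat.
    by exists w, b, [::], r; rewrite cats1.
  (* If [q] is empty, the jump is made at the last letter [b]; otherwise it was made earlier and the
     induction hypothesis applies. *)
  case=> p [a [q [t []]]]; case/lastP: q => [|q c].
    by rewrite cats1 => /rcons_inj[-> ->] Rt <-; right.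
  rewrite -rcons_cons -rcons_cat => /rcons_inj[w_def ->] Rt.
  rewrite foldl_rcons => <-; left; apply: imset_f; apply/IH.
  by exists p, a, q, t.
split=> [[p [a [q [t [z_def Rt tF]]]]]|/set0Pn[r /setIP[/run2]]].
  apply/set0Pn; exists (foldl (@dfa_trans A N) t q); rewrite inE tF andbT.
  by apply/run2; exists p, a, q, t.
by case=> p [a [q [t [z_def Rt <-]]]] tF; exists p, a, q, t.
Qed.

Lemma regular_crossover (A : finType) (L1 L2 : language A) :
  regular L1 -> regular L2 -> regular (fun z => exists a u1 v1 u2 v2,
    [/\ L1 (u1 ++ a :: v1), L2 (u2 ++ a :: v2) & z = u1 ++ a :: v2]).
Proof.
move=> [M LM] [N LN].
(* [live] provides the discarded right context [v1], [enters] the discarded left context [u2]. *)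
apply: regular_ext (regular_jump
  (fun s a (t : dfa_state N) => live (@dfa_trans A M s a) && enters a t)) => z.
split=> [[p [a [q [t [-> /andP[/liveP[v vF] /entersP[u ut]] tF]]]]]|].
  exists a, p, v, u, q; split=> //.
    by apply/LM; rewrite /dfa_accept foldl_cat.
  by apply/LN; rewrite /dfa_accept foldl_cat /= ut.
case=> a [u1 [v1 [u2 [v2 [/LM + /LN + ->]]]]].
rewrite /dfa_accept !foldl_cat /= => vF1 vF2.
exists u1, a, v2, (dfa_trans (foldl (@dfa_trans A N) (dfa_init N) u2) a).
split=> //; apply/andP; split; first by apply/liveP; exists v1.
by apply/entersP; exists u2.
Qed.

Lemma regular_common_letter (A : finType) (L1 L2 : language A) :
  regular L1 -> regular L2 -> regular (fun z => exists a u1 v1 u2 v2,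
    [/\ L1 (u1 ++ a :: v1), L2 (u2 ++ a :: v2) & z = u1 ++ a :: v1]).
Proof.
move=> [M LM] [N LN].
(* Here the jump stays in [M] and follows its own transition, so the run is not altered; it only
   marks a letter [a] that also occurs in some word of [L2]. *)
apply: regular_ext (regular_jump (fun s a t => (t == @dfa_trans A M s a)
  && [exists r : dfa_state N, enters a r && live r])) => z.
split=> [[p [a [q [t [-> /andP[/eqP-> /existsP[r]]]]]]]|].
  move=> /andP[/entersP[u <-] /liveP[v vF]] tF.
  exists a, p, q, u, v; split=> //.
    by apply/LM; rewrite /dfa_accept foldl_cat.
  by apply/LN; rewrite /dfa_accept foldl_cat.
case=> a [u1 [v1 [u2 [v2 [/LM + /LN + ->]]]]].
rewrite /dfa_accept !foldl_cat /= => vF1 vF2.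
exists u1, a, v1, (dfa_trans (foldl (@dfa_trans A M) (dfa_init M) u1) a).
split=> //; rewrite eqxx; apply/existsP.
exists (dfa_trans (foldl (@dfa_trans A N) (dfa_init N) u2) a); apply/andP.
by split; [apply/entersP; exists u2 | apply/liveP; exists v2].
Qed.

Lemma GSA_letterP (A : finType) (L1 L2 : language A) z :
  GSA L1 L2 z <-> exists a u1 v1 u2 v2,
    [/\ L1 (u1 ++ a :: v1), L2 (u2 ++ a :: v2)
      & z \in [:: u1 ++ a :: v1; u2 ++ a :: v2; u1 ++ a :: v2; u2 ++ a :: v1]].
Proof.
split=> [[w1 [w2 [Lw1 Lw2 [[|a x] [// _ _ _]]]]]|].
  move=> [u1 [v1 [u2 [v2 [w1_def w2_def zP]]]]].
  (* Both right contexts receive the same tail [x], so the four words do not change. *)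
  by exists a, u1, (x ++ v1), u2, (x ++ v2); rewrite -w1_def -w2_def in zP *.
case=> a [u1 [v1 [u2 [v2 [Lw1 Lw2 zP]]]]].
exists (u1 ++ a :: v1), (u2 ++ a :: v2); split=> //.
exists [:: a]; split=> //; try exact: (infix_infix _ [:: a]).
by exists u1, v1, u2, v2.
Qed.

Theorem theorem5 (A : finType) (L1 L2 : language A)
  (hL1 : regular L1) (hL2 : regular L2) : regular (GSA L1 L2).
Proof.
(* Each lemma is used twice, since exchanging [L1] and [L2] turns the words from [u1] into those
   from [u2]. *)
apply: regular_ext (regularU
  (regularU (regular_common_letter hL1 hL2) (regular_common_letter hL2 hL1))
  (regularU (regular_crossover hL1 hL2) (regular_crossover hL2 hL1))) => z.
split.
  by move=> zP; apply/GSA_letterP; case: zP=> -[] [a [u1 [v1 [u2 [v2 [Lw1 Lw2 ->]]]]]];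
    [exists a, u1, v1, u2, v2 | exists a, u2, v2, u1, v1
    |exists a, u1, v1, u2, v2 | exists a, u2, v2, u1, v1];
    split=> //; rewrite !inE eqxx ?orbT.
case/GSA_letterP=> a [u1 [v1 [u2 [v2 [Lw1 Lw2]]]]]; rewrite !inE.
case/or4P=> /eqP z_def; [left; left|left; right|right; left|right; right];
  by [exists a, u1, v1, u2, v2 | exists a, u2, v2, u1, v1].
Qed.
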